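(* There is an algorithm that, given an idempotent permutation $\pi\in IP(n,k)$ whose characteristic function $\varphi$ is defined implicitly, generates the corresponding idempotent map $\iota\in I(n,k)$ in-place of $\pi$ in $\mathcal{O}(kn)$ time using $4\log n$ bits.
   Context: $[n]=\{1,\ldots,n\}$. $I(n,k)$ is the set of idempotent maps $\iota:[n]\to[n]$ ($\iota(\iota(x))=\iota(x)$ for all $x$) with image of cardinality $k$. An idempotent permutation of degree $k$ ($1\le k\le n$) is a permutation $\pi$ of $[n]$ together with a distinguished set of indices $A=\{a_1<\cdots<a_k\}\subseteq[n]$ such that the values $c_i=\pi(a_i)$ satisfy $1=c_1<c_2<\cdots<c_k$. The values $c_i$ are called the fixed elements of $\pi$ (this does not mean $\pi(c_i)=c_i$), the others idle. Put $c_{k+1}=n+1$ and $[a_i]_\pi=\{x\in[n]:c_i\le\pi(x)<c_{i+1}\}$. $IP(n,k)$ denotes the set of idempotent permutations of degree $k$. The idempotent map corresponding to $\pi$ is the map $\iota\in I(n,k)$ with $\iota(x)=a_i$ for all $x\in[a_i]_\pi$, $i=1,\ldots,k$. The characteristic function $\varphi(x)=1$ if $x\in A$ and $0$ otherwise is ''defined implicitly'' when $\pi$ is stored with fixed elements negated: the entry at $x$ is $-\pi(x)$ if $x\in A$ and $\pi(x)$ otherwise. ''In-place'' means the array $D[1\ldots n]$ (entries integers in $[-n,n]$) initially holds this signed version of $\pi$ and finally holds $\iota$. Computation is on a unit-cost random access machine; ''$4\log n$ bits'' means that besides the array 4 auxiliary variables of $\log n$ bits each (indices or values of magnitude $O(n)$)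 are used. *)

(* Defs.v *)
From mathcomp Require Import all_boot all_order all_algebra all_fingroup.

Set Implicit Arguments.
Unset Strict Implicit.
Unset Printing Implicit Defensive.

Import Order.TTheory GRing.Theory Num.Theory.
Local Open Scope ring_scope.

(** * Idempotent maps and idempotent permutations *)

(* [n] = {1, ..., n} is represented by 'I_n; [pos] recovers the 1-based
   element, which matters because the sign of an array entry carries phi. *)
Definition pos n (x : 'I_n) : nat := x.+1.

Definition idem_map (n k : nat) (f : {ffun 'I_n -> 'I_n}) : Prop :=
  (forall x, f (f x) = f x) /\ #|[set f x | x : 'I_n]| = k.

(* [ip_idx] is the increasing enumeration a_1 < ... < a_k of A, so a_i is
   [ip_idx] at the ordinal of value i - 1. *)
Record idem_perm (n k : nat) := IdemPerm {
  ip_perm :> {perm 'I_n};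
  ip_idx : {ffun 'I_k -> 'I_n};
  ip_idx_incr : forall i j : 'I_k,
    (i < j)%N -> (pos (ip_idx i) < pos (ip_idx j))%N;
  ip_val_incr : forall i j : 'I_k,
    (i < j)%N -> (pos (ip_perm (ip_idx i)) < pos (ip_perm (ip_idx j)))%N;
  ip_val_first : forall i : 'I_k,
    i = 0%N :> nat -> pos (ip_perm (ip_idx i)) = 1%N
}.

Section IdempotentPermutation.
Variables (n k : nat) (p : idem_perm n k).

Definition ip_set : {set 'I_n} := [set ip_idx p i | i : 'I_k].

(* c_{i+1} for i < k, and c_{k+1} = n + 1 for i = k. *)
Definition fixed_val (i : nat) : nat :=
  if insub i is Some j then pos (p (ip_idx p j)) else n.+1.

Definition block (i : 'I_k) : {set 'I_n} :=
  [set x | (fixed_val i <= pos (p x) < fixed_val i.+1)%N].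

(* The blocks partition 'I_n, so at most one map satisfies this. *)
Definition corresponds (f : {ffun 'I_n -> 'I_n}) : Prop :=
  forall (i : 'I_k) (x : 'I_n), x \in block i -> f x = ip_idx p i.

Definition signed_array : {ffun 'I_n -> int} :=
  [ffun x => if x \in ip_set then - (pos (p x))%:Z else (pos (p x))%:Z].

End IdempotentPermutation.

Definition map_array n (f : {ffun 'I_n -> 'I_n}) : {ffun 'I_n -> int} :=
  [ffun x => (pos (f x))%:Z].

(** * A unit-cost random access machine
   A program is a fixed list of instructions; its only storage is the array
   D[1..n] and [w] integer registers.  The length n is a read-only operand. *)

Inductive operand (w : nat) :=
| Const of int
| Len
| Reg of 'I_w
| Cell of 'I_w.  (* D[r], indirect through register r *)

Inductive dest (w : nat) :=
| ToReg of 'I_w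
| ToCell of 'I_w.

Inductive instr (w : nat) :=
| Add of dest w & operand w & operand w
| Sub of dest w & operand w & operand w
| JumpLt of operand w & operand w & nat
| Halt.

Arguments Const {w}.
Arguments Len {w}.
Arguments Halt {w}.

Definition program (w : nat) := seq (instr w).

Record config (w n : nat) := Config {
  pc : nat;
  regs : {ffun 'I_w -> int};
  mem : {ffun 'I_n -> int}
}.

Section Machine.
Variables (w n : nat).
Implicit Types (P : program w) (c : config w n).

Definition addr (a : int) : option 'I_n :=
  if a is Posz i.+1 then insub i else None.

Definition eval c (o : operand w) : option int :=
  match o with
  | Const z => Some z
  | Len => Some n%:Z
  | Reg r => Some (regs c r)
  | Cell r => omap (mem c) (addr (regs c r))
  end.

Definition upd (T : finType) (f : {ffun T -> int}) (a : T) (v : int) :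
  {ffun T -> int} := [ffun b => if b == a then v else f b].

Definition store c (d : dest w) (v : int) : option (config w n) :=
  match d with
  | ToReg r => Some (Config (pc c).+1 (upd (regs c) r v) (mem c))
  | ToCell r =>
      omap (fun x => Config (pc c).+1 (regs c) (upd (mem c) x v))
           (addr (regs c r))
  end.

(* [None] when the machine has halted or is stuck: an address outside 1..n,
   or a program counter outside the program. *)
Definition step P c : option (config w n) :=
  match onth P (pc c) with
  | Some (Add d o1 o2) =>
      obind (fun u => obind (fun v => store c d (u + v)) (eval c o2))
            (eval c o1)
  | Some (Sub d o1 o2) =>
      obind (fun u => obind (fun v => store c d (u - v)) (eval c o2))
            (eval c o1)
  | Some (JumpLt o1 o2 l) =>
      obind (fun u => omap (fun v =>
        Config (if u < v then l else (pc c).+1) (regs c) (mem c)) (eval c o2))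
            (eval c o1)
  | Some Halt | None => None
  end.

Fixpoint run P (t : nat) c : option (config w n) :=
  if t is s.+1 then obind (run P s) (step P c) else Some c.

Definition halted P c : Prop := onth P (pc c) = Some Halt.

Definition init (D : {ffun 'I_n -> int}) : config w n :=
  Config 0 [ffun=> 0] D.

(* Registers of magnitude at most B n, that is of log n + O(1) bits each, and
   array entries in [-n, n]. *)
Definition within (B : nat) c : Prop :=
  (forall r, `|regs c r| <= (B * n)%N%:Z) /\
  (forall x, `|mem c x| <= n%:Z).

(* [P] transforms D into D' within [T] steps, every intermediate configuration
   respecting the space bound. *)
Definition computes_in_place P (D D' : {ffun 'I_n -> int}) (T B : nat) : Prop :=
  exists (t : nat) (c : config w n),
    [/\ (t <= T)%N, run P t (init D) = Some c, halted P c, mem c = D' &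
        forall (s : nat) (c' : config w n),
          (s <= t)%N -> run P s (init D) = Some c' -> within B c'].

End Machine.

(* Main.v *)
(* Phase 1 replaces idle entries by the index of their block: with i a counter
   of the fixed elements already met, every entry in [i, c_{i+1}) becomes i when
   the scan meets c_{i+1}.  Block indices written earlier are below i, and
   i <= c_i, so exactly the idle entries of block i are hit.  The last block is
   left as it is.  Phase 2 scans from right to left and, when it meets a_i,
   replaces the entries equal to i (all entries at least k if i = k) and the
   fixed entry itself by a_i.  Entries a_j written earlier satisfy
   a_j >= j > i, so they survive.  Each phase costs one scan and k passes over
   the array, and uses the scanning index, the counter, the index of the inner
   pass and its upper bound as the only registers. *)

Require Import Defs.
From mathcomp Require Import all_boot all_order all_algebra all_fingroup.
From mathcomp Require Import zify.

Set Implicit Arguments.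
Unset Strict Implicit.
Unset Printing Implicit Defensive.

Import Order.TTheory GRing.Theory Num.Theory.

(** * Bounded executions *)

Section Reach.
Variables (w n B : nat) (P : program w).
Implicit Types c : config w n.

(** [T] is only an upper bound on time, so branches of different cost can share one estimate. The
    space bound covers all configurations passed through, both ends included, and hence survives
    concatenation of runs. *)
Definition reach T c c' : Prop :=
  exists t, [/\ (t <= T)%N, run P t c = Some c' &
    forall s c'', (s <= t)%N -> run P s c = Some c'' -> within B c''].

Lemma reach_refl c : within B c -> reach 0 c c.
Proof. by move=> Wc; exists 0%N; split=> // [[|s]] //= c'' _ [<-]. Qed.

Lemma reach_le T T' c c' : (T <= T')%N -> reach T c c' -> reach T' c c'.
Proof.
by move=> leT [t [tT r W]]; exists t; split=> //; apply: leq_trans leT.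
Qed.

Lemma reach_step T c c1 c' :
  step P c = Some c1 -> within B c -> reach T c1 c' -> reach T.+1 c c'.
Proof.
move=> e Wc [t [tT r W]]; exists t.+1; split=> //=; first by rewrite e.
by move=> [|s] c'' /=; [move=> _ [<-] | rewrite e /=; apply: W].
Qed.

Lemma reach_trans T1 T2 c1 c2 c3 :
  reach T1 c1 c2 -> reach T2 c2 c3 -> reach (T1 + T2) c1 c3.
Proof.
case=> t [tT]; elim: t T1 c1 tT => [|t IH] T1 c1 tT /=.
  by case=> -> _ r; apply: reach_le r; rewrite leq_addl.
case: T1 tT => // T1 tT; case e: (step P c1) => [c|] //= r W r2.
apply: (reach_step e); first exact: (W 0%N c1).
by apply: (IH T1) => // s c'' st rs; apply: (W s.+1 c'') => //=; rewrite e.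
Qed.

End Reach.

Arguments reach_step {w n B P T c} c1 {c'}.
Arguments reach_le {w n B P} T {T' c c'}.

(** * The program *)

Definition rZ : 'I_4 := @Ordinal 4 0 isT.
Definition rI : 'I_4 := @Ordinal 4 1 isT.
Definition rX : 'I_4 := @Ordinal 4 2 isT.
Definition rH : 'I_4 := @Ordinal 4 3 isT.

Definition jump (l : nat) : instr 4 := JumpLt (Const 0) (Const 1) l.
Definition set_reg (r : 'I_4) (z : int) : instr 4 :=
  Add (ToReg r) (Const z) (Const 0).

(* A subroutine entered at [b] and left to [e]: it overwrites by register [r]
   every entry in the interval [I, H). *)
Definition pass_code (b e : nat) (r : 'I_4) : program 4 :=
  [:: JumpLt (Reg rX) Len b.+2; jump e;
      Add (ToReg rX) (Reg rX) (Const 1);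
      JumpLt (Cell rX) (Reg rI) b;
      JumpLt (Cell rX) (Reg rH) b.+4.+2; jump b;
      Add (ToCell rX) (Reg r) (Const 0); jump b].

(** [rZ] is the scanning index, [rI] the counter of fixed elements, [rX] the index of the inner
    pass, [rH] its exclusive upper bound. Phase 1 occupies addresses 0-16, its pass 7-14; address 17
    sets [rH] to n + 1; phase 2 occupies 18-35, its pass 24-31. *)
Definition idem_program : program 4 :=
  [:: JumpLt (Reg rZ) Len 2; jump 17;
      Add (ToReg rZ) (Reg rZ) (Const 1);
      JumpLt (Cell rZ) (Const 0) 5; jump 0;
      Defs.Sub (ToReg rH) (Const 0) (Cell rZ);
      set_reg rX 0] ++
  pass_code 7 15 rI ++
  [:: Add (ToReg rI) (Reg rI) (Const 1); jump 0;
      Add (ToReg rH) Len (Const 1);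
      JumpLt (Const 0) (Reg rZ) 20; Halt;
      JumpLt (Cell rZ) (Const 0) 22; jump 34;
      Add (ToCell rZ) (Reg rZ) (Const 0);
      set_reg rX 0] ++
  pass_code 24 32 rZ ++
  [:: Add (ToReg rH) (Reg rI) (Const 0);
      Defs.Sub (ToReg rI) (Reg rI) (Const 1);
      Defs.Sub (ToReg rZ) (Reg rZ) (Const 1); jump 18].

Definition regfile (z i x h : nat) : {ffun 'I_4 -> int} :=
  [ffun r : 'I_4 => (nth 0%N [:: z; i; x; h] r)%:Z%R].

Definition state n l z i x h (D : {ffun 'I_n -> int}) : config 4 n :=
  Config l (regfile z i x h) D.

Definition bounded n (D : {ffun 'I_n -> int}) : Prop :=
  forall x, (`|D x| <= n%:Z)%R.

(** * Execution of the inner pass *)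

Section Execution.
Variable n : nat.
Implicit Types (D : {ffun 'I_n -> int}) (z i x h l : nat) (v : int).

(** The factor 2 makes room for the value n + 1 of [rH], as n + 1 <= 2n for n >= 1. *)
Lemma within_state l z i x h D :
  (z <= 2 * n)%N -> (i <= 2 * n)%N -> (x <= 2 * n)%N -> (h <= 2 * n)%N ->
  bounded D -> within 2 (state l z i x h D).
Proof.
move=> hz hi hx hh bD; split=> //= r; rewrite ffunE.
by case: r => [[|[|[|[|r]]]] lt_r] //=; lia.
Qed.

Lemma upd_rZ z i x h v u : v = u%:Z%R ->
  upd (regfile z i x h) rZ v = regfile u i x h.
Proof.
by move=> ->; apply/ffunP; case=> [[|[|[|[|r]]]] lt_r]; rewrite !ffunE.
Qed.

Lemma upd_rI z i x h v u : v = u%:Z%R ->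
  upd (regfile z i x h) rI v = regfile z u x h.
Proof.
by move=> ->; apply/ffunP; case=> [[|[|[|[|r]]]] lt_r]; rewrite !ffunE.
Qed.

Lemma upd_rX z i x h v u : v = u%:Z%R ->
  upd (regfile z i x h) rX v = regfile z i u h.
Proof.
by move=> ->; apply/ffunP; case=> [[|[|[|[|r]]]] lt_r]; rewrite !ffunE.
Qed.

Lemma upd_rH z i x h v u : v = u%:Z%R ->
  upd (regfile z i x h) rH v = regfile z i x u.
Proof.
by move=> ->; apply/ffunP; case=> [[|[|[|[|r]]]] lt_r]; rewrite !ffunE.
Qed.

Lemma bounded_upd D (y : 'I_n) v :
  (`|v| <= n%:Z)%R -> bounded D -> bounded (upd D y v).
Proof. by move=> hv bD x; rewrite ffunE; case: eqP. Qed.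

Definition in_range (i h : nat) v : bool := ((i%:Z <= v) && (v < h%:Z))%R.

Lemma in_range_nat i h u : in_range i h u%:Z%R = (i <= u < h)%N.
Proof. by rewrite /in_range !lez_nat ltz_nat. Qed.

Lemma in_range_neg i h u : in_range i h (- u.+1%:Z)%R = false.
Proof. by rewrite /in_range; lia. Qed.

Definition pass (i h : nat) v D : {ffun 'I_n -> int} :=
  [ffun y => if in_range i h (D y) then v else D y].

(** Loop invariant of the pass: the cells with addresses 1..m have been treated. The test may refer
    to the original [D] because each cell is visited once. *)
Definition pass_upto m i h v D : {ffun 'I_n -> int} :=
  [ffun y : 'I_n => if (y < m)%N && in_range i h (D y) then v else D y].

Lemma pass_upto0 i h v D : pass_upto 0 i h v D = D.
Proof. by apply/ffunP=> y; rewrite ffunE. Qed.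

Lemma pass_upto_full i h v D : pass_upto n i h v D = pass i h v D.
Proof. by apply/ffunP=> y; rewrite !ffunE ltn_ord. Qed.

Lemma pass_upto_at i h v D (y : 'I_n) : pass_upto y i h v D y = D y.
Proof. by rewrite ffunE ltnn. Qed.

Lemma pass_uptoS i h v D (y : 'I_n) :
  pass_upto y.+1 i h v D =
  if in_range i h (D y) then upd (pass_upto y i h v D) y v
  else pass_upto y i h v D.
Proof.
apply/ffunP=> a; rewrite ffunE ltnS leq_eqVlt val_eqE.
case: (a =P y) => [->|/eqP/negbTE ne] /=; case: (in_range i h (D y)).
- by rewrite ffunE eqxx.
- by rewrite ffunE ltnn.
- by rewrite !ffunE ne.
- by rewrite ffunE.
Qed.

Lemma bounded_pass_upto m i h v D :
  (`|v| <= n%:Z)%R -> bounded D -> bounded (pass_upto m i h v D).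
Proof. by move=> hv bD y; rewrite ffunE; case: ifP. Qed.

(** An iteration that writes executes six instructions, the others fewer, and leaving the loop takes
    two. The pass modifies only [rX] among the registers, so the value written from [rZ] or [rI] is
    constant. *)
Lemma reach_pass (P : program 4) b e (r : 'I_4) z i h D :
  (forall j, (j < 8)%N -> onth P (b + j) = onth (pass_code b e r) j) ->
  r = rZ \/ r = rI ->
  (z <= n)%N -> (i <= n)%N -> (h <= n.+1)%N -> (0 < n)%N -> bounded D ->
  reach 2 P (6 * n + 2) (state b z i 0 h D)
    (state e z i n h (pass i h (regfile z i 0 h r) D)).
Proof.
move=> hP hr hz hi hh n0 bD; set v := regfile _ _ _ _ r.
have bv : (`|v| <= n%:Z)%R by rewrite /v ffunE; case: hr => -> /=; lia.
have hv x : regfile z i x h r = v by rewrite /v !ffunE; case: hr => ->.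
rewrite -pass_upto_full -[in state b _ _ _ _ _](pass_upto0 i h v D).
have P0 := hP 0%N isT; have P1 := hP 1%N isT; have P2 := hP 2%N isT.
have P3 := hP 3%N isT; have P4 := hP 4%N isT; have P5 := hP 5%N isT.
have P6 := hP 6%N isT; have P7 := hP 7%N isT.
rewrite /= ?addnS ?addn0 in P0 P1 P2 P3 P4 P5 P6 P7.
suff loop d m : (m + d)%N = n -> reach 2 P (6 * d + 2)
    (state b z i m h (pass_upto m i h v D))
    (state e z i n h (pass_upto n i h v D)) by exact: (loop n 0%N).
elim: d m => [|d IH] m hm.
  have -> : m = n by lia.
  have bE := bounded_pass_upto n i h bv bD.
  apply: (reach_step (state b.+1 z i n h (pass_upto n i h v D))).
  - by rewrite /step [pc _]/= P0 /= ffunE /= ltxx.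
  - by apply: within_state => //; lia.
  apply: (reach_step (state e z i n h (pass_upto n i h v D))).
  - by rewrite /step [pc _]/= P1.
  - by apply: within_state => //; lia.
  by apply: reach_refl; apply: within_state => //; lia.
have lt_m : (m < n)%N by lia.
pose y := Ordinal lt_m.
have bE := bounded_pass_upto m i h bv bD.
apply: (reach_le ((6 * d + 2).+4.+2)); first by lia.
apply: (reach_step (state b.+2 z i m h (pass_upto m i h v D))).
  by rewrite /step [pc _]/= P0 /= ffunE /= ltz_nat lt_m.
  by apply: within_state => //; lia.
apply: (reach_step (state b.+3 z i m.+1 h (pass_upto m i h v D))).
  rewrite /step [pc _]/= P2 /= ffunE /= (@upd_rX _ _ _ _ _ m.+1) //; lia.
  by apply: within_state => //; lia.
have ev l : eval (state l z i m.+1 h (pass_upto m i h v D)) (Cell rX) =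
    Some (D y).
  rewrite /eval /= ffunE /=; rewrite -[m]/(val y) valK /=.
  by congr Some; apply: (pass_upto_at i h v D y).
(* In the two cases without a write, [E] says that the invariants for [m] and [m.+1] are the same
   array. *)
have := pass_uptoS i h v D y; rewrite /in_range leNgt.
case lt_i: (D y < i%:Z)%R => /= E.
  apply: (reach_step (state b z i m.+1 h (pass_upto m i h v D))).
  - by rewrite /step [pc _]/= P3 ev /= ffunE /= lt_i.
  - by apply: within_state => //; lia.
  by rewrite -E; apply: reach_le (IH m.+1 _); lia.
apply: (reach_step (state b.+4 z i m.+1 h (pass_upto m i h v D))).
  by rewrite /step [pc _]/= P3 ev /= ffunE /= lt_i.
  by apply: within_state => //; lia.
case lt_h: (D y < h%:Z)%R in E.
  apply: (reach_step (state b.+4.+2 z i m.+1 h (pass_upto m i h v D))).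
  - by rewrite /step [pc _]/= P4 ev /= ffunE /= lt_h.
  - by apply: within_state => //; lia.
  have bE' := bounded_pass_upto m.+1 i h bv bD.
  apply: (reach_step (state b.+4.+3 z i m.+1 h (pass_upto m.+1 i h v D))).
  - by rewrite /step [pc _]/= P6 /= hv ffunE /= -[m]/(val y) valK /= E addr0.
  - by apply: within_state => //; lia.
  apply: (reach_step (state b z i m.+1 h (pass_upto m.+1 i h v D))).
  - by rewrite /step [pc _]/= P7.
  - by apply: within_state => //; lia.
  by apply: IH; lia.
apply: (reach_step (state b.+4.+1 z i m.+1 h (pass_upto m i h v D))).
  by rewrite /step [pc _]/= P4 ev /= ffunE /= lt_h.
  by apply: within_state => //; lia.
apply: (reach_step (state b z i m.+1 h (pass_upto m i h v D))).
  by rewrite /step [pc _]/= P5.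
  by apply: within_state => //; lia.
by rewrite -E; apply: reach_le (IH m.+1 _); lia.
Qed.

End Execution.

(** * Ranks *)

Lemma card_ord_lt k m : (m <= k)%N -> #|[set j : 'I_k | (j < m)%N]| = m.
Proof.
move=> le_mk; rewrite -sum1dep_card -(big_ord_widen k (fun=> 1%N) le_mk).
by rewrite sum1_card card_ord.
Qed.

(** * Counting in strictly increasing sequences *)

Section Increasing.
Variables (k : nat) (g : 'I_k -> nat).
Hypothesis g_incr : forall i j : 'I_k, (i < j)%N -> (g i < g j)%N.

Lemma incr_lt (i j : 'I_k) : (g i < g j)%N = (i < j)%N.
Proof.
case: (ltngtP i j) => [/g_incr //|/g_incr|/val_inj ->]; last exact: ltnn.
by move=> lt_g; apply/negbTE; rewrite -leqNgt ltnW.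
Qed.

Lemma incr_ge_id (j : 'I_k) : (j <= g j)%N.
Proof.
case: j => m; elim: m => [|m IH] lt_m //=.
apply: leq_ltn_trans (IH (ltnW lt_m)) _; exact: g_incr.
Qed.

(** The indices with [g i <= v] form an initial segment, which contains [j] exactly when its length
    exceeds [j]. *)
Lemma count_le_incr v (j : 'I_k) : (j < #|[set i | g i <= v]|)%N = (g j <= v)%N.
Proof.
apply/idP/idP => [|le_v].
  apply: contraTT; rewrite -ltnNge -leqNgt => lt_g.
  rewrite -[X in (_ <= X)%N](card_ord_lt (ltnW (ltn_ord j))).
  apply/subset_leq_card/subsetP => i; rewrite !inE -incr_lt => le_v.
  exact: leq_ltn_trans lt_g.
rewrite -(card_ord_lt (ltn_ord j)).
apply/subset_leq_card/subsetP => i; rewrite !inE ltnS => le_ij.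
by apply: leq_trans le_v; rewrite leqNgt incr_lt -leqNgt.
Qed.

End Increasing.

(** * Block ranks, the corresponding idempotent map and the array invariants *)

Section IdemPerm.
Variables (n k : nat) (p : idem_perm n k).
Hypothesis k_gt0 : (0 < k)%N.
Implicit Types (x : 'I_n) (j : 'I_k).

Local Notation a := (ip_idx p).
Local Notation c := (fun j => val (p (a j))).

Lemma ip_idx_lt (i j : 'I_k) : (a i < a j)%N = (i < j)%N.
Proof. exact: (@incr_lt _ (fun j => val (a j)) (@ip_idx_incr _ _ p)). Qed.

Lemma ip_idx_inj : injective a.
Proof.
move=> i j e; apply/val_inj; case: (ltngtP i j) => //;
  by rewrite -ip_idx_lt e ltnn.
Qed.

Lemma ip_val_incr0 (i j : 'I_k) : (i < j)%N -> (c i < c j)%N.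
Proof. exact: (@ip_val_incr _ _ p). Qed.

(** The 1-based index of the block of [x]: as the fixed values increase, counting those up to [p x]
    locates the last of them. *)
Definition rank x : nat := #|[set j | c j <= p x]|.

Lemma lt_rank x j : (j < rank x)%N = (p (a j) <= p x)%N.
Proof. exact: count_le_incr ip_val_incr0 _ _. Qed.

(** This is where c_1 = 1 enters: the first fixed value is the least value, so it is always
    counted. *)
Lemma rank_gt0 x : (0 < rank x)%N.
Proof.
have -> : 0%N = Ordinal k_gt0 by [].
by rewrite lt_rank -ltnS -[X in (X < _)%N]/(pos _).-1 ip_val_first.
Qed.

Lemma rank_le x : (rank x <= k)%N.
Proof. by rewrite /rank -[X in (_ <= X)%N]card_ord max_card. Qed.

Lemma rank_idx j : rank (a j) = j.+1.
Proof.
apply/eqP; rewrite eqn_leq lt_rank leqnn andbT leqNgt; apply/negP => lt_j.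
have lt_jk := leq_trans lt_j (rank_le _).
have := lt_rank (a j) (Ordinal lt_jk); rewrite /= lt_j => /esym.
by rewrite leqNgt ip_val_incr0.
Qed.

(** Ranks lie in 1..k, so after the shift to 0-based indices [insub] succeeds and the default [x] is
    not reached. *)
Definition imap : {ffun 'I_n -> 'I_n} :=
  [ffun x => oapp a x (insub (rank x).-1)].

Lemma imapP x : exists2 j : 'I_k, rank x = j.+1 & imap x = a j.
Proof.
have lt_k : ((rank x).-1 < k)%N by rewrite prednK ?rank_gt0 ?rank_le.
exists (Ordinal lt_k); first by rewrite /= prednK ?rank_gt0.
by rewrite ffunE insubT.
Qed.

Lemma imap_rank x j : rank x = j.+1 -> imap x = a j.
Proof. by case: (imapP x) => i -> -> [] /val_inj ->. Qed.

Lemma imap_idx j : imap (a j) = a j.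
Proof. exact/imap_rank/rank_idx. Qed.

Lemma imap_idem : idem_map k imap.
Proof.
split=> [x|]; first by case: (imapP x) => j _ ->; apply: imap_idx.
rewrite -[RHS](card_ord k) -(card_imset _ ip_idx_inj); congr #|pred_of_set _|.
apply/setP=> y; apply/imsetP/imsetP => [[x _ ->]|[j _ ->]].
  by case: (imapP x) => j _ ->; exists j.
by exists (a j); rewrite ?imap_idx.
Qed.

(** Turns membership in a block into a condition on ranks. For [i >= k] both sides hold, by the
    convention c_{k+1} = n + 1 and because ranks are at most [k]. *)
Lemma lt_fixed_val x i : (pos (p x) < fixed_val p i)%N = (rank x <= i)%N.
Proof.
rewrite /fixed_val; case: insubP => [j _ <-|].
  by rewrite ltnS ltnNge -lt_rank -leqNgt.
by rewrite -leqNgt ltnS ltn_ord => /(leq_trans (rank_le x)) ->.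
Qed.

Lemma imap_corresponds : corresponds p imap.
Proof.
move=> j x; rewrite inE leqNgt !lt_fixed_val => /andP[lt_j ge_j].
by apply: imap_rank; apply/eqP; rewrite eqn_leq ge_j ltnNge.
Qed.

Lemma mem_ip_set x : reflect (exists j, x = a j) (x \in ip_set p).
Proof. by apply: (iffP imsetP) => [[j _ ->]|[j ->]]; exists j. Qed.

(** Follows from c_i >= i. It places the untouched idle entries of block i above the lower end of
    the interval of their pass. *)
Lemma rank_le_val x : (rank x <= pos (p x))%N.
Proof.
case: (imapP x) => j e _; rewrite e ltnS.
apply: leq_trans (incr_ge_id ip_val_incr0 j) _.
by rewrite -lt_rank e.
Qed.

(** Follows from a_i >= i. It keeps the entries already resolved in phase 2 out of the later
    intervals. *)
Lemma rank_le_imap x : (rank x <= pos (imap x))%N.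
Proof.
case: (imapP x) => j -> ->; rewrite /pos ltnS.
exact: (@incr_ge_id _ (fun j => val (a j)) (@ip_idx_incr _ _ p)).
Qed.

(** The content of [rI] when [rZ] holds [m] at the head of either scanning loop. *)
Definition idx_below (m : nat) : nat := #|[set j | (a j < m)%N]|.

Lemma idx_below0 : idx_below 0 = 0%N.
Proof. by apply: eq_card0 => j; rewrite inE. Qed.

Lemma idx_below_full : idx_below n = k.
Proof. by rewrite -[RHS]card_ord; apply: eq_card => j; rewrite inE ltn_ord. Qed.

Lemma idx_below_idle x :
  x \notin ip_set p -> idx_below x.+1 = idx_below x.
Proof.
move=> xA; apply: eq_card => j; rewrite !inE ltnS leq_eqVlt val_eqE.
by case: eqP => // e; case/mem_ip_set: xA; exists j.
Qed.

Lemma idx_below_idx j : idx_below (a j) = j.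
Proof.
rewrite -[RHS](card_ord_lt (ltnW (ltn_ord j))); apply: eq_card => i.
by rewrite !inE ip_idx_lt.
Qed.

Lemma idx_below_idxS j : idx_below (a j).+1 = j.+1.
Proof.
rewrite -[RHS](card_ord_lt (ltn_ord j)); apply: eq_card => i.
by rewrite !inE !ltnS leqNgt ip_idx_lt -leqNgt.
Qed.

(* Phase 1 after [i] passes, and phase 2 when the passes for a_i, ..., a_1
   remain. *)
Definition ranked (i : nat) : {ffun 'I_n -> int} :=
  [ffun x => if x \in ip_set p then - (pos (p x))%:Z
             else if (rank x < i)%N then (rank x)%:Z else (pos (p x))%:Z]%R.

Definition resolved (i : nat) : {ffun 'I_n -> int} :=
  [ffun x => if (i < rank x)%N then (pos (imap x))%:Z else ranked k x]%R.

Lemma resolvedE i x : resolved i x =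
  (if (i < rank x)%N then (pos (imap x))%:Z
   else if x \in ip_set p then - (pos (p x))%:Z
   else if (rank x < k)%N then (rank x)%:Z else (pos (p x))%:Z)%R.
Proof. by rewrite ffunE [ranked _ _]ffunE. Qed.

Lemma bounded_ranked i : bounded (ranked i).
Proof.
move=> x; rewrite ffunE; have := rank_le_val x; have := ltn_ord (p x).
by rewrite /pos; do 2?case: ifP => _; lia.
Qed.

Lemma bounded_resolved i : bounded (resolved i).
Proof.
move=> x; rewrite ffunE; case: ifP => _; last exact: bounded_ranked.
by have := ltn_ord (imap x); rewrite /pos; lia.
Qed.

Lemma ranked0 : ranked 0 = signed_array p.
Proof. by apply/ffunP=> x; rewrite !ffunE ltn0. Qed.

Lemma resolved_full : resolved k = ranked k.
Proof. by apply/ffunP=> x; rewrite ffunE ltnNge rank_le. Qed.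

Lemma resolved0 : resolved 0 = map_array imap.
Proof. by apply/ffunP=> x; rewrite !ffunE rank_gt0. Qed.

(** The sign still records the characteristic function on the blocks that the leftward scan has yet
    to resolve. *)
Lemma resolved_neg x i :
  (resolved i x < 0)%R = (x \in ip_set p) && (rank x <= i)%N.
Proof.
rewrite !ffunE ltnNge; case: (rank x <= i)%N; rewrite /= ?andbF //=.
by case: ifP => _ //; case: ifP.
Qed.

Lemma ranked_neg x i : (ranked i x < 0)%R = (x \in ip_set p).
Proof. by rewrite !ffunE; case: ifP => // _; case: ifP. Qed.

(** Since [j] is 0-based, [a j] carries c_{j+1} and the pass completes block [j]. For [j = 0] the
    interval is [0, 1), which contains no entry, so no 0 is written. *)
Lemma ranked_pass j :
  pass j (pos (p (a j))) j%:Z%R (ranked j) = ranked j.+1.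
Proof.
apply/ffunP=> x; rewrite !ffunE /in_range.
case: (x \in ip_set p) => //=.
have := rank_le_val x; have := lt_rank x j; have := incr_ge_id ip_val_incr0 j.
rewrite /pos /= ltnS; case: (ltngtP (rank x) j) => hr *; case: ifP; lia.
Qed.

(** Below [k] the interval [i, upper i) is the single value i. At [k] it reaches up to n, since the
    last block still holds its original values, all at least k. *)
Definition upper (i : nat) : nat := if (i < k)%N then i.+1 else n.+1.

Lemma resolved_pass j :
  pass j.+1 (upper j.+1) (pos (a j))%:Z%R
    (upd (resolved j.+1) (a j) (pos (a j))%:Z%R) = resolved j.
Proof.
apply/ffunP=> x; rewrite [LHS]ffunE [upd _ _ _ _]ffunE !resolvedE.
(* The cell [a j] already holds its own address, and the pass can only write the same value there
   again. *)
case: eqP => [->|ne]; first by rewrite rank_idx imap_idx ltnSn; case: ifP.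
have := rank_le x; have := rank_le_imap x; have := rank_le_val x.
have := ltn_ord (p x); have := ltn_ord j; rewrite /upper /pos.
have [lt_r|gt_r|eq_r] := ltngtP (rank x) j.+1 => *.
- case: (x \in ip_set p); first by rewrite in_range_neg.
  case: (ltnP (rank x) k) => hr; rewrite in_range_nat.
    by rewrite leqNgt lt_r.
  lia.
- by rewrite in_range_nat; case: (ltnP j.+1 k) => ?; case: andP => // -[]; lia.
(* Rank determines a fixed position, so a fixed [x] of this rank would be [a j], against [ne]. *)
rewrite eq_r (imap_rank eq_r); case: (boolP (x \in ip_set p)) => [xA|_].
  have [i ei] := mem_ip_set x xA; rewrite ei rank_idx in eq_r.
  by case: ne; rewrite ei; congr (a _); apply/val_inj; case: eq_r.
case: (ltnP j.+1 k) => ?; rewrite in_range_nat ?leqnn ?ltnSn //.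
by case: andP => // -[]; lia.
Qed.

End IdemPerm.

(** * Correctness of the program *)

Section Program.
Variables (n k : nat) (p : idem_perm n k).
Hypotheses (k_gt0 : (0 < k)%N) (le_kn : (k <= n)%N).
Local Notation a := (ip_idx p).
Implicit Types (D : {ffun 'I_n -> int}).
Local Notation reachP T := (reach 2 idem_program T).

Lemma step_test_neg l l' (x : 'I_n) i y h D :
  onth idem_program l = Some (JumpLt (Cell rZ) (Const 0) l') ->
  step idem_program (state l x.+1 i y h D) =
    Some (state (if (D x < 0)%R then l' else l.+1) x.+1 i y h D).
Proof. by move=> e; rewrite /step [pc _]/= e /= ffunE /= valK. Qed.

Lemma step_neg_cell (x : 'I_n) i y h u D : (D x = - u%:Z)%R ->
  step idem_program (state 5 x.+1 i y h D) = Some (state 6 x.+1 i y u D).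
Proof.
by move=> e; rewrite /step /= ffunE /= valK /= e (@upd_rH _ _ _ _ _ u) //; lia.
Qed.

Lemma idx_below_le m : (idx_below p m <= k)%N.
Proof. by rewrite -[X in (_ <= X)%N]card_ord max_card. Qed.

Lemma pass7 z i h D :
  (z <= n)%N -> (i <= n)%N -> (h <= n.+1)%N -> bounded D ->
  reachP (6 * n + 2) (state 7 z i 0 h D)
    (state 15 z i n h (pass i h i%:Z%R D)).
Proof.
move=> hz hi hh bD; have n0 := leq_trans k_gt0 le_kn.
have := @reach_pass n idem_program 7 15 rI z i h D _ _ hz hi hh n0 bD.
rewrite [regfile _ _ _ _ _]ffunE; apply; last by right.
by do 8?case=> //.
Qed.

Lemma pass24 z i h D :
  (z <= n)%N -> (i <= n)%N -> (h <= n.+1)%N -> bounded D ->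
  reachP (6 * n + 2) (state 24 z i 0 h D)
    (state 32 z i n h (pass i h z%:Z%R D)).
Proof.
move=> hz hi hh bD; have n0 := leq_trans k_gt0 le_kn.
have := @reach_pass n idem_program 24 32 rZ z i h D _ _ hz hi hh n0 bD.
rewrite [regfile _ _ _ _ _]ffunE; apply; last by left.
by do 8?case=> //.
Qed.

Local Ltac in_bounds := by apply: within_state => //; lia.

(** Induction on the number [d] of cells left to scan. An idle cell costs four instructions, a fixed
    one 6n + 9 including its pass, and the exit two. *)
Lemma phase1 d m x h :
  (m + d)%N = n -> (x <= n)%N -> (h <= n.+1)%N ->
  let i := idx_below p m in
  exists x' h', [/\ (x' <= n)%N, (h' <= n.+1)%N &
    reachP (4 * d + (k - i) * (6 * n + 9) + 2)
      (state 0 m i x h (ranked p i)) (state 17 n k x' h' (ranked p k))].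
Proof.
elim: d m x h => [|d IH] m x h hm hx hh i.
  have em : m = n by lia.
  have ei : i = k by rewrite /i em idx_below_full.
  have bD := bounded_ranked p k_gt0 k.
  exists x, h; split=> //; rewrite em ei.
  apply: (reach_le 2); first by lia.
  apply: (reach_step (state 1 n k x h (ranked p k))).
  - by rewrite /step /= ffunE /= ltxx.
  - in_bounds.
  apply: (reach_step (state 17 n k x h (ranked p k))).
  - by [].
  - in_bounds.
  by apply: reach_refl; in_bounds.
have lt_m : (m < n)%N by lia.
pose y := Ordinal lt_m.
have le_ik : (i <= k)%N := idx_below_le m.
have bD := bounded_ranked p k_gt0 i.
have S0 : step idem_program (state 0 m i x h (ranked p i)) =
          Some (state 2 m i x h (ranked p i)).
  by rewrite /step /= ffunE /= ltz_nat lt_m.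
have S2 : step idem_program (state 2 m i x h (ranked p i)) =
          Some (state 3 m.+1 i x h (ranked p i)).
  by rewrite /step /= ffunE /= (@upd_rZ _ _ _ _ _ m.+1) //; lia.
have [yA|yA] := boolP (y \in ip_set p).
  have [j ej] := mem_ip_set p y yA.
  have eij : i = j by rewrite /i -[m]/(val y) ej idx_below_idx.
  have eij1 : idx_below p m.+1 = j.+1.
    by rewrite -[m]/(val y) ej idx_below_idxS.
  set h1 := pos (p (a j)).
  have hh1 : (h1 <= n)%N by rewrite /h1 /pos ltn_ord.
  have bD' := bounded_ranked p k_gt0 j.+1.
  have [x' [h' [hx' hh' R]]] := IH m.+1 n h1 ltac:(lia) (leqnn n) ltac:(lia).
  exists x', h'; split=> //.
  apply: (reach_le
    (6 * n + 2 + (4 * d + (k - j.+1) * (6 * n + 9) + 2).+2).+4.+1).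
    have -> : (k - i = (k - j.+1).+1)%N by have := ltn_ord j; lia.
    by rewrite mulSn; lia.
  apply: (reach_step _ S0); first in_bounds.
  apply: (reach_step _ S2); first in_bounds.
  apply: (reach_step (state 5 m.+1 i x h (ranked p i))).
  - by rewrite (@step_test_neg 3 5 y) // ranked_neg yA.
  - in_bounds.
  apply: (reach_step (state 6 m.+1 i x h1 (ranked p i))).
  - by apply: (@step_neg_cell y); rewrite ffunE yA ej.
  - in_bounds.
  apply: (reach_step (state 7 m.+1 i 0 h1 (ranked p i))).
  - by rewrite /step /= (@upd_rX _ _ _ _ _ 0%N).
  - in_bounds.
  apply: reach_trans; first by apply: pass7 => //; lia.
  rewrite eij ranked_pass //.
  apply: (reach_step (state 16 m.+1 j.+1 n h1 (ranked p j.+1))).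
  - by rewrite /step /= ffunE /= (@upd_rI _ _ _ _ _ j.+1) //; lia.
  - in_bounds.
  apply: (reach_step (state 0 m.+1 j.+1 n h1 (ranked p j.+1))).
  - by [].
  - have lt_jk := ltn_ord j; in_bounds.
  by rewrite eij1 in R.
have ei : idx_below p m.+1 = i by rewrite /i -[m]/(val y) idx_below_idle.
have [x' [h' [hx' hh' R]]] := IH m.+1 x h ltac:(lia) hx hh.
rewrite ei in R; exists x', h'; split=> //.
apply: (reach_le (4 * d + (k - i) * (6 * n + 9) + 2).+4); first by lia.
apply: (reach_step _ S0); first in_bounds.
apply: (reach_step _ S2); first in_bounds.
apply: (reach_step (state 4 m.+1 i x h (ranked p i))).
- by rewrite (@step_test_neg 3 5 y) // ranked_neg (negbTE yA).
- in_bounds.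
apply: (reach_step (state 0 m.+1 i x h (ranked p i))).
- by [].
- in_bounds.
exact: R.
Qed.

(** Induction on the number [m] of cells left. An idle cell costs five instructions, a fixed one 6n
    + 10 including its pass, and the exit test one. *)
Lemma phase2 m x :
  (m <= n)%N -> (x <= n)%N ->
  let i := idx_below p m in
  exists c, [/\ pc c = 19, Defs.mem c = map_array (imap p) &
    reachP (5 * m + i * (6 * n + 10) + 1)
      (state 18 m i x (upper n k i) (resolved p i)) c].
Proof.
elim: m x => [|m IH] x hm hx i.
  have bD := bounded_resolved p k_gt0 0.
  have hu : (upper n k 0 <= n.+1)%N by rewrite /upper k_gt0; lia.
  exists (state 19 0 0 x (upper n k 0) (resolved p 0)); split=> //.
    by rewrite -resolved0.
  rewrite /i idx_below0.
  apply: (reach_step (state 19 0 0 x (upper n k 0) (resolved p 0))).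
  - by rewrite /step /= ffunE.
  - in_bounds.
  by apply: reach_refl; in_bounds.
pose y := Ordinal hm.
have le_ik : (i <= k)%N := idx_below_le m.+1.
have bD := bounded_resolved p k_gt0 i.
have hu i' : (i' <= k)%N -> (upper n k i' <= n.+1)%N
  by rewrite /upper; case: ifP; lia.
have hui := hu i le_ik.
set h := upper n k i in hui *.
have S0 : step idem_program (state 18 m.+1 i x h (resolved p i)) =
          Some (state 20 m.+1 i x h (resolved p i)).
  by rewrite /step /= ffunE.
have S34 i' x' h' D : step idem_program (state 34 m.+1 i' x' h' D) =
          Some (state 35 m i' x' h' D).
  by rewrite /step /= ffunE /= (@upd_rZ _ _ _ _ _ m) //; lia.
have [yA|yA] := boolP (y \in ip_set p); last first.
  have ei : i = idx_below p m by rewrite /i -[m.+1]/(val y).+1 idx_below_idle.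
  have [c [pcc mc R]] := IH x (ltnW hm) hx; rewrite -ei in R.
  exists c; split=> //.
  apply: (reach_le (5 * m + i * (6 * n + 10) + 1).+4.+1); first by lia.
  apply: (reach_step _ S0); first in_bounds.
  apply: (reach_step (state 21 m.+1 i x h (resolved p i))).
  - by rewrite (@step_test_neg 20 22 y) // resolved_neg (negbTE yA).
  - in_bounds.
  apply: (reach_step (state 34 m.+1 i x h (resolved p i))).
  - by [].
  - in_bounds.
  apply: (reach_step _ (S34 _ _ _ _)); first in_bounds.
  apply: (reach_step (state 18 m i x h (resolved p i))).
  - by [].
  - in_bounds.
  exact: R.
have [j ej] := mem_ip_set p y yA.
have eij : i = j.+1 by rewrite /i -[m]/(val y) ej idx_below_idxS.
have eij1 : idx_below p m = j by rewrite -[m]/(val y) ej idx_below_idx.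
have rank_y : rank p y = j.+1 by rewrite ej rank_idx.
have em : pos (a j) = m.+1 by rewrite -ej.
have lt_jk := ltn_ord j.
have bD' := bounded_resolved p k_gt0 j.
(* As [j < k], the next bound [upper n k j] is [j.+1], the old counter, which is copied to [rH]
   before [rI] is decremented. *)
have [c [pcc mc R]] := IH n (ltnW hm) (leqnn n); rewrite eij1 /upper lt_jk in R.
exists c; split=> //.
apply: (reach_le
    (6 * n + 2 + (5 * m + j * (6 * n + 10) + 1).+4).+4).
  by rewrite eij mulSn; lia.
apply: (reach_step _ S0); first in_bounds.
apply: (reach_step (state 22 m.+1 i x h (resolved p i))).
- by rewrite (@step_test_neg 20 22 y) // resolved_neg yA rank_y eij leqnn.
- in_bounds.
pose D1 := upd (resolved p i) y m.+1%:Z%R.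
have bD1 : bounded D1 by apply: bounded_upd => //; lia.
apply: (reach_step (state 23 m.+1 i x h D1)).
- by rewrite /step /= ffunE /= -[m]/(val y) valK /= addr0.
- in_bounds.
apply: (reach_step (state 24 m.+1 i 0 h D1)).
- by rewrite /step /= (@upd_rX _ _ _ _ _ 0%N).
- in_bounds.
apply: reach_trans; first by apply: pass24 => //; lia.
rewrite /D1 /h eij ej -em resolved_pass // em -eij -/h.
apply: (reach_step (state 33 m.+1 i n i (resolved p j))).
- by rewrite /step /= ffunE /= (@upd_rH _ _ _ _ _ i) //; lia.
- in_bounds.
apply: (reach_step (state 34 m.+1 j n i (resolved p j))).
- by rewrite /step /= ffunE /= (@upd_rI _ _ _ _ _ j) //; lia.
- in_bounds.
apply: (reach_step _ (S34 _ _ _ _)); first in_bounds.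
apply: (reach_step (state 18 m j n i (resolved p j))).
- by [].
- in_bounds.
by rewrite eij.
Qed.

Lemma idem_program_correct :
  computes_in_place idem_program (signed_array p) (map_array (imap p))
    (100 * (k * n)) 2.
Proof.
have [x [h [hx hh R1]]] := phase1 (add0n n) (leq0n n) (leq0n n.+1).
have [c [pcc mc R2]] := phase2 (leqnn n) hx.
rewrite idx_below0 ranked0 // in R1.
rewrite idx_below_full resolved_full /upper ltnn in R2.
have bD := bounded_ranked p k_gt0 k.
have R : reachP (100 * (k * n)) (init 4 (signed_array p)) c.
  have -> : init 4 (signed_array p) = state 0 0 0 0 0 (signed_array p).
    congr Config; apply/ffunP.
    by case=> [[|[|[|[|r]]]] lt_r] //; rewrite !ffunE.
  (* The phases and the instruction between them take at most 12kn + 19k + 9n + 4 steps, below 100kn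
     because 1 <= k <= n. *)
  apply: reach_le (reach_trans R1 (reach_step _ _ _ R2)); first by nia.
  - by rewrite /step /= (@upd_rH _ _ _ _ _ n.+1) //; lia.
  - in_bounds.
have [t [tT r W]] := R.
by exists t, c; split=> //; rewrite /halted pcc.
Qed.

End Program.

Theorem theorem3p13 :
  exists (P : program 4) (C B : nat),
    forall (n k : nat) (hk : (1 <= k <= n)%N) (p : idem_perm n k),
    exists f : {ffun 'I_n -> 'I_n},
      [/\ idem_map k f, corresponds p f &
          computes_in_place P (signed_array p) (map_array f) (C * (k * n)) B].
Proof.
exists idem_program, 100, 2 => n k /andP[k_gt0 le_kn] p; exists (imap p).
split; [exact: imap_idem | exact: imap_corresponds |].
exact: idem_program_correct.
Qed.
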